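(* Let $G$ be a group which admits a c$\mathcal{Z}$-boundary and let $H$ be a group which is quasi-isometric to $G$. Then $H$ admits a c$\mathcal{Z}$-boundary. In fact, $G$ and $H$ admit the same c$\mathcal{Z}$-boundaries: a space $Z$ is a c$\mathcal{Z}$-boundary for $G$ if and only if it is a c$\mathcal{Z}$-boundary for $H$.
   Context: Groups called quasi-isometric are finitely generated and are compared via word metrics with respect to finite generating sets. (A group admitting a c$\mathcal{Z}$-structure, defined below, is automatically finitely generated.) All spaces are separable and metrizable. Coarse near-actions. Let $(X,d)$ and $(Y,d')$ be metric spaces. Let $\rho_-,\rho_+:[0,\infty)\to[0,\infty)$ be nondecreasing with $\rho_-(r)\to\infty$ as $r\to\infty$. A (not necessarily continuous) function $f:X\to Y$ is a $(\rho_-,\rho_+)$-coarse embedding if $\rho_-(d(x_1,x_2))\le d'(f(x_1),f(x_2))\le\rho_+(d(x_1,x_2))$ for all $x_1,x_2\in X$. A coarse near-action of a group $G$ on $(X,d)$ is a function $\psi$ assigning to each $\gamma\in G$ a function $\psi(\gamma):X\to X$ such that, for some $C\ge 0$ and some such pair $(\rho_-,\rho_+)$ (independent of $\gamma$): $d(\psi(1)(x),x)\le C$ for all $x\in X$; $d(\psi(\gamma_1\gamma_2)(x),\psi(\gamma_1)\psi(\gamma_2)(x))\le C$ for all $x\in X$, $\gamma_1,\gamma_2\in G$; and every $\psi(\gamma)$ is a $(\rho_-,\rho_+)$-coarse embedding. It is cobounded if there exist $x_0\in X$ and $R>0$ such that for all $y\in X$ there is $\gamma\in G$ with $d(\psi(\gamma)(x_0),y)<R$.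 It is proper if for each $R>0$ there is $M\in\mathbb{N}$ such that for all $x,y\in X$, $|\{\gamma\in G : \psi(\gamma)(B_d[x,R])\cap B_d[y,R]\ne\emptyset\}|\le M$, where $B_d[x,R]$ is the closed ball. Model $\mathcal{Z}$-geometries. An ANR is a locally compact (separable metrizable) space $X$ such that whenever $X$ is embedded as a closed subset of another space $Y$, some neighborhood of $X$ in $Y$ retracts onto $X$; an AR is a contractible ANR. A metric space is proper if all closed balls are compact; it is cocompact if there are $x_0\in X$, $R>0$ such that the balls $B_d[\gamma x_0,R]$, $\gamma\in\operatorname{Isom}(X)$, cover $X$. A model geometry is a proper, cocompact metric AR $(X,d)$. A closed subset $A$ of a space $Y$ is a $\mathcal{Z}$-set if there is a homotopy $H:Y\times[0,1]\to Y$ with $H_0=\operatorname{id}_Y$ and $H_t(Y)\subset Y-A$ for all $t>0$. A $\mathcal{Z}$-compactification of $X$ is a compactification $\overline X=X\sqcup Z$ with $Z$ a $\mathcal{Z}$-set in $\overline X$. It is controlled (with respect to $d$) if for every $R>0$ and every open cover $\mathcal{U}$ of $\overline X$ there is a compact set $C\subset X$ such that every $A\subseteq X-C$ with $\operatorname{diam}_d A<R$ is contained in some $U\in\mathcal{U}$. A model $\mathcal{Z}$-geometry $(\overline X,Z,d)$ is a controlled $\mathcal{Z}$-compactification $\overline X=X\sqcup Z$ of a model geometry $(X,d)$. A coarse $\mathcal{Z}$-structure (c$\mathcal{Z}$-structure) on a group $G$ consists of a model $\mathcal{Z}$-geometry $(\overline X,Z,d)$ together with a proper, cobounded, coarse near-action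 of $G$ on $(X,d)$; then $Z$ is called a coarse $\mathcal{Z}$-boundary (c$\mathcal{Z}$-boundary) for $G$. *)

(* Defs.v *)
From HB Require Import structures.
From mathcomp Require Import all_boot all_order all_algebra.
From mathcomp Require Import all_classical all_reals all_analysis.

Set Implicit Arguments.
Unset Strict Implicit.
Unset Printing Implicit Defensive.

Import Order.TTheory GRing.Theory Num.Theory.
Import numFieldNormedType.Exports.

Local Open Scope classical_set_scope.
Local Open Scope ring_scope.

Definition word_in (G : groupType) (S : set G) (s : seq G) : Prop :=
  forall x, x \in s -> S x \/ S (x^-1)%g.

Definition generates (G : groupType) (S : set G) : Prop :=
  forall g, exists2 s : seq G, word_in S s & (\prod_(x <- s) x)%g = g.

(* The least length of a word in S and its inverses that represents g^-1 h
   (junk value 0 if there is no such word). *)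
Definition word_dist (R : realType) (G : groupType) (S : set G) (g h : G) : R :=
  inf [set (size s)%:R |
       s in [set s : seq G | word_in S s /\ (\prod_(x <- s) x = g^-1 * h)%g]].

Definition quasi_isometry (R : realType) (A B : Type)
    (dA : A -> A -> R) (dB : B -> B -> R) (f : A -> B) : Prop :=
  exists K C : R,
    [/\ 1 <= K, 0 <= C,
        forall x y, K^-1 * dA x y - C <= dB (f x) (f y) <= K * dA x y + C
      & forall b, exists a, dB (f a) b <= C].

Definition quasi_isometric (R : realType) (G H : groupType) : Prop :=
  exists (S : set G) (T : set H),
    [/\ finite_set S, generates S, finite_set T, generates T
      & exists f : G -> H,
          quasi_isometry (@word_dist R G S) (@word_dist R H T) f].

Definition homeomorphism (X Y : topologicalType) (f : X -> Y) : Prop :=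
  exists g : Y -> X, [/\ cancel f g, cancel g f, continuous f & continuous g].

Definition embedding (X Y : topologicalType) (f : X -> Y) : Prop :=
  injective f /\
  (forall A : set X, open A <-> exists2 B : set Y, open B & A = f @^-1` B).

Definition metrizable (R : realType) (X : topologicalType) : Prop :=
  exists (M : metricType R) (f : X -> M), homeomorphism f.

Definition separable (X : topologicalType) : Prop :=
  exists2 D : set X, countable D & dense D.

Definition sep_metrizable (R : realType) (X : topologicalType) : Prop :=
  separable X /\ metrizable R X.

(* A homotopy Y x [0,1] -> Y is represented by a map on Y x R of which only
   the restriction to Y x [0,1] matters. *)
Definition homotopy (R : realType) (Y : topologicalType) (H : Y * R -> Y) :
    Prop :=
  {within [set: Y] `*` [set` `[0, 1]], continuous H}.

Definition contractible (R : realType) (X : topologicalType) : Prop :=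
  exists (x0 : X) (H : X * R -> X),
    [/\ homotopy H, forall x, H (x, 0) = x & forall x, H (x, 1) = x0].

(* r restricts to a retraction of the subset U of Y onto its subset A. *)
Definition retraction (Y : topologicalType) (U A : set Y) (r : Y -> Y) : Prop :=
  [/\ {within U, continuous r}, r @` U `<=` A & forall a, A a -> r a = a].

Definition ANR (R : realType) (X : topologicalType) : Prop :=
  [/\ locally_compact [set: X], sep_metrizable R X
    & forall (Y : topologicalType) (e : X -> Y),
        sep_metrizable R Y -> embedding e -> closed (range e) ->
        exists2 U : set Y, set_nbhs (range e) U
                         & exists r : Y -> Y, retraction U (range e) r].

Definition AR (R : realType) (X : topologicalType) : Prop :=
  contractible R X /\ ANR R X.

Definition Z_set (R : realType) (Y : topologicalType) (A : set Y) : Prop :=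
  closed A /\
  exists H : Y * R -> Y,
    [/\ homotopy H, forall y, H (y, 0) = y
      & forall y t, 0 < t -> t <= 1 -> ~ A (H (y, t))].

(* The library's closed_ball is the closure of the open ball. *)
Definition cball (R : realType) (X : metricType R) (x : X) (r : R) : set X :=
  [set y | mdist x y <= r].

(* The empty set has diameter -oo, which is below every R > 0 just as 0 is. *)
Definition diam (R : realType) (X : metricType R) (A : set X) : \bar R :=
  ereal_sup [set (mdist p.1 p.2)%:E | p in A `*` A].

Definition metric_isometry (R : realType) (X : metricType R) (f : X -> X) :
    Prop :=
  bijective f /\ forall x y, mdist (f x) (f y) = mdist x y.

Definition proper_space (R : realType) (X : metricType R) : Prop :=
  forall (x : X) (r : R), compact (cball x r).

Definition cocompact (R : realType) (X : metricType R) : Prop :=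
  exists (x0 : X) (r : R), 0 < r /\
    \bigcup_(f in [set f | metric_isometry f]) cball (f x0) r = [set: X].

Definition model_geometry (R : realType) (X : metricType R) : Prop :=
  [/\ proper_space X, cocompact X & AR R X].

Definition compactification (R : realType) (X Xbar : topologicalType)
    (i : X -> Xbar) : Prop :=
  [/\ sep_metrizable R Xbar, compact [set: Xbar], embedding i
    & dense (range i)].

(* The decomposition of Xbar as the disjoint union of X and Z is given by
   embeddings i of X and j of Z with complementary ranges. *)
Definition Z_compactification (R : realType) (X Xbar Z : topologicalType)
    (i : X -> Xbar) (j : Z -> Xbar) : Prop :=
  [/\ compactification R i, embedding j, range j = ~` range i
    & Z_set R (range j)].

Definition controlled (R : realType) (X : metricType R) (Xbar : topologicalType)
    (i : X -> Xbar) : Prop :=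
  forall (r : R) (U : set (set Xbar)),
    0 < r -> U `<=` open -> \bigcup_(V in U) V = [set: Xbar] ->
    exists2 C : set X, compact C
      & forall A : set X, A `<=` ~` C -> (diam A < r%:E)%E ->
          exists2 V, U V & i @` A `<=` V.

Definition model_Z_geometry (R : realType) (X : metricType R)
    (Xbar Z : topologicalType) (i : X -> Xbar) (j : Z -> Xbar) : Prop :=
  [/\ model_geometry X, Z_compactification R i j & controlled i].

Definition control_pair (R : realType) (rho_m rho_p : R -> R) : Prop :=
  [/\ forall r : R, 0 <= r -> 0 <= rho_m r /\ 0 <= rho_p r,
      {in Num.nneg &, {homo rho_m : r s / r <= s}},
      {in Num.nneg &, {homo rho_p : r s / r <= s}}
    & rho_m r @[r --> +oo] --> +oo].

Definition coarse_embedding (R : realType) (X Y : metricType R)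
    (rho_m rho_p : R -> R) (f : X -> Y) : Prop :=
  forall x1 x2,
    rho_m (mdist x1 x2) <= mdist (f x1) (f x2) <= rho_p (mdist x1 x2).

Definition coarse_near_action (R : realType) (G : groupType) (X : metricType R)
    (psi : G -> X -> X) : Prop :=
  exists (C : R) (rho_m rho_p : R -> R),
    [/\ 0 <= C, control_pair rho_m rho_p,
        forall x, mdist (psi 1%g x) x <= C,
        forall g1 g2 x, mdist (psi (g1 * g2)%g x) (psi g1 (psi g2 x)) <= C
      & forall g, coarse_embedding rho_m rho_p (psi g)].

Definition cobounded_near_action (R : realType) (G : groupType)
    (X : metricType R) (psi : G -> X -> X) : Prop :=
  exists (x0 : X) (r : R), 0 < r /\
    forall y, exists g, mdist (psi g x0) y < r.

Definition proper_near_action (R : realType) (G : groupType)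
    (X : metricType R) (psi : G -> X -> X) : Prop :=
  forall r : R, 0 < r -> exists M : nat, forall x y : X,
    ([set g | (psi g @` cball x r) `&` cball y r !=set0] #<= `I_M)%card.

Definition cZ_structure (R : realType) (G : groupType) (X : metricType R)
    (Xbar Z : topologicalType) (i : X -> Xbar) (j : Z -> Xbar)
    (psi : G -> X -> X) : Prop :=
  [/\ model_Z_geometry i j, coarse_near_action psi,
      proper_near_action psi & cobounded_near_action psi].

Definition cZ_boundary (R : realType) (G : groupType) (Z : topologicalType) :
    Prop :=
  exists (X : metricType R) (Xbar : topologicalType) (i : X -> Xbar)
         (j : Z -> Xbar) (psi : G -> X -> X), cZ_structure i j psi.

(* Main.v *)
(** An orbit map of a proper cobounded coarse near-action of G on X is a coarse
    equivalence from G to X.  Conversely, a coarse equivalence q : G -> X with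
    coarse inverse p yields the proper cobounded coarse near-action
    psi g x = q (g * p x) of G on X.  A quasi-isometry is a coarse equivalence,
    so the near-action can be carried from G to H while the model Z-geometry,
    and hence Z, stays the same.

    A group has its left-invariant coarse structure, in which the controlled
    sets are those where g^-1 h stays in a finite set; for a finite generating
    set, it is the one of the word metric. *)

Require Import Defs.
From mathcomp Require Import all_boot all_order all_algebra.
From mathcomp Require Import all_classical all_reals all_analysis.

Import Order.TTheory GRing.Theory Num.Theory.
Import numFieldNormedType.Exports.

Local Open Scope classical_set_scope.
Local Open Scope ring_scope.

Set Implicit Arguments.
Unset Strict Implicit.
Unset Printing Implicit Defensive.

(** * Coarse structures and coarse equivalences *)

(* In the library's [D \; D'], the relation [D'] comes first. *)
Definition coarse_structure (A : Type) (E : set (set (A * A))) : Prop :=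
  [/\ forall D D', D `<=` D' -> E D' -> E D,
      forall D D', E D -> E D' -> E (D \; D')%relation
    & forall D, E D -> E (D^-1)%relation].

(** A coarse embedding with coarsely dense image; this form avoids carrying a coarse inverse, which
    is recovered by choice below. *)
Definition coarse_equivalence (A B : Type) (EA : set (set (A * A)))
    (EB : set (set (B * B))) (f : A -> B) : Prop :=
  [/\ forall D, EA D -> EB [set (f p.1, f p.2) | p in D],
      forall D, EB D -> EA [set p | D (f p.1, f p.2)]
    & exists2 D, EB D & forall b, exists a, D (f a, b)].

Lemma coarse_equivalence_comp (A B C : Type) (EA : set (set (A * A)))
    (EB : set (set (B * B))) (EC : set (set (C * C))) (f : A -> B) (g : B -> C) :
  coarse_structure EC -> coarse_equivalence EA EB f ->
  coarse_equivalence EB EC g -> coarse_equivalence EA EC (g \o f).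
Proof.
move=> [Esub Ecomp _] [f1 f2 [Df EDf fS]] [g1 g2 [Dg EDg gS]]; split.
- move=> D /f1/g1; apply: Esub => _ [[a a'] Daa' <-] /=.
  by exists (f a, f a') => //; exists (a, a').
- by move=> D /g2/f2.
- exists (Dg \; [set (g p.1, g p.2) | p in Df])%relation.
    by apply: Ecomp => //; exact: g1.
  move=> c; have [b Dgb] := gS c; have [a Dfa] := fS b.
  by exists a, (g b) => //=; exists (f a, b).
Qed.

(** The inverse picks [f' b] with [f (f' b)] close to [b]. Controlled sets are then compared in [B],
    where swapping [b] for [f (f' b)] costs one factor [D0] or its inverse at each end. *)
Lemma coarse_equivalence_inverse (A B : Type) (EA : set (set (A * A)))
    (EB : set (set (B * B))) (f : A -> B) :
  coarse_structure EA -> coarse_structure EB -> coarse_equivalence EA EB f ->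
  exists f' : B -> A, coarse_equivalence EB EA f'.
Proof.
move=> [Asub _ _] [Bsub Bcomp Binv] [f1 f2 [D0 ED0 /choice[f' f'P]]].
exists f'; split.
- move=> D ED; apply: Asub (f2 _ (Bcomp _ _ (Bcomp _ _ (Binv _ ED0) ED) ED0)).
  move=> _ [[b b'] Dbb' <-] /=; exists b => //; exists b' => //=; exact: f'P.
- move=> D ED; apply: Bsub (Bcomp _ _ (Bcomp _ _ ED0 (f1 _ ED)) (Binv _ ED0)).
  move=> [b b'] /= Dbb'; exists (f (f' b)); first exact: f'P.
  by exists (f (f' b')); [exists (f' b, f' b')|exact: f'P].
- by eexists; [exact: f2 ED0|move=> a; exists (f a) => /=; exact: f'P].
Qed.

(** * Controlled sets of groups and of word metrics *)

Definition group_controlled (G : groupType) : set (set (G * G)) :=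
  [set D | exists2 F : set G, finite_set F
                            & forall g h, D (g, h) -> F (g^-1 * h)%g].

Definition dist_controlled (R : realType) (A : Type) (d : A -> A -> R) :
    set (set (A * A)) :=
  [set D | exists r, forall x y, D (x, y) -> d x y <= r].

Lemma group_controlled_coarse (G : groupType) :
  coarse_structure (@group_controlled G).
Proof.
split.
- by move=> D D' DD' [F finF FP]; exists F => // g h /DD'/FP.
- move=> D D' [F finF FP] [F' finF' FP'].
  exists [set (x * y)%g | x in F' & y in F]; first exact: finite_image2.
  move=> g h [k /= /FP' gk /FP kh]; exists (g^-1 * k)%g => //.
  by exists (k^-1 * h)%g => //; rewrite mulgA mulgK.
- move=> D [F finF FP]; exists [set (x^-1)%g | x in F]; first exact: finite_image.
  by move=> g h /FP gh; exists (h^-1 * g)%g => //; rewrite invgM invgK.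
Qed.

Lemma mdist_controlled_coarse (R : realType) (X : metricType R) :
  coarse_structure (dist_controlled (@mdist R X)).
Proof.
split.
- by move=> D D' DD' [r rP]; exists r => x y /DD'/rP.
- move=> D D' [r rP] [s sP]; exists (s + r) => x y [z /= /sP xz /rP zy].
  by rewrite (le_trans (metric_triangle _ z _))// lerD.
- by move=> D [r rP]; exists r => x y /rP; rewrite metric_sym.
Qed.

Lemma quasi_isometry_coarse (R : realType) (A B : Type)
    (dA : A -> A -> R) (dB : B -> B -> R) (f : A -> B) :
  quasi_isometry dA dB f ->
  coarse_equivalence (dist_controlled dA) (dist_controlled dB) f.
Proof.
move=> [K [C [K1 C0 fP fS]]]; have K0 : 0 < K by exact: lt_le_trans K1.
split.
- move=> D [r rP]; exists (K * r + C) => _ _ [[x y] /rP dxy [<- <-]].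
  have /andP[_ /le_trans->]// := fP x y.
  by rewrite lerD2r ler_pM2l.
- move=> D [r rP]; exists (K * (r + C)) => x y /rP/= dxy.
  have /andP[+ _] := fP x y; rewrite lerBlDr => /le_trans/(_ (lerD dxy (lexx _))).
  by rewrite mulrC ler_pdivrMr// mulrC.
- exists [set p | dB p.1 p.2 <= C]; first by exists C.
  by move=> b; have [a] := fS b; exists a.
Qed.

(** By induction on [n]: a nonempty word is a letter from the finite set of generators and inverses,
    followed by a shorter word. *)
Lemma finite_word_ball (G : groupType) (S : set G) (n : nat) : finite_set S ->
  finite_set [set (\prod_(x <- s) x)%g |
              s in [set s : seq G | word_in S s /\ (size s <= n)%N]].
Proof.
move=> finS; elim: n => [|n IHn].
  apply: (@sub_finite_set _ _ [set 1%g]) => // _ [[|x s] [_ +] <-] //.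
  by rewrite big_nil.
pose T := S `|` [set (x^-1)%g | x in S].
have finT : finite_set T by rewrite finite_setU; split=> //; exact: finite_image.
set B := [set _ | _ in _] in IHn.
apply: (@sub_finite_set _ _ ([set 1%g] `|` [set (x * y)%g | x in T & y in B])).
  move=> _ [[|x s] [sS sn] <-]; first by left; rewrite big_nil.
  right; rewrite big_cons; exists x.
    have [|Sx] := sS x (mem_head _ _); first by left.
    by right; exists (x^-1)%g => //; rewrite invgK.
  exists (\prod_(y <- s) y)%g => //; exists s => //; split => // y ys.
  by apply: sS; rewrite in_cons ys orbT.
by rewrite finite_setU; split=> //; exact: finite_image2.
Qed.

Lemma finite_set_has_ubound (R : realDomainType) (A : set R) :
  finite_set A -> has_ubound A.
Proof.
move=> /finite_seqP[s ->]; elim: s => [|x s [r rP]].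
  by exists 0 => y /=; rewrite in_nil.
exists (Num.max x r) => y /=; rewrite in_cons le_max => /orP[/eqP->|ys].
  by rewrite lexx.
by rewrite (rP y ys) orbT.
Qed.

(** Balls of the word metric are finite, and a finite set of elements has bounded word length. Hence
    the coarse structure does not depend on the finite generating set. *)
Lemma word_dist_controlled (R : realType) (G : groupType) (S : set G) :
  finite_set S -> generates S ->
  dist_controlled (@word_dist R G S) = @group_controlled G.
Proof.
move=> finS genS; apply/seteqP; split => D.
(* A strict bound above the infimum yields an actual word shorter than [n], without showing that the
   infimum is attained. *)
- move=> [r rP]; have [n rn] : exists n : nat, r < n%:R.
    by exists (Num.bound `|r|); exact: le_lt_trans (ler_norm _) (archi_boundP _).
  eexists; first exact: (finite_word_ball n finS).
  move=> g h /rP; rewrite /word_dist => /le_lt_trans/(_ rn) /inf_lt[].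
    by have [s sS sP] := genS (g^-1 * h)%g; exists (size s)%:R, s.
  by move=> _ [s [sS sP] <-]; rewrite ltr_nat => /ltnW sn; exists s.
- move=> [F finF FP]; have /choice[w wP] : forall g, exists s : seq G,
      word_in S s /\ (\prod_(x <- s) x)%g = g.
    by move=> g; have [s sS sP] := genS g; exists s.
  have [r rP] : has_ubound [set ((size (w g))%:R : R) | g in F].
    by apply: finite_set_has_ubound; exact: finite_image.
  exists r => g h /FP gh; apply: le_trans (rP _ (imageP _ gh)).
  apply: ge_inf; first by exists 0 => _ [s _ <-].
  by exists (w (g^-1 * h)%g).
Qed.

(** * Near-actions and coarse equivalences *)

(** Up to [C], the points [psi g x0] and [psi h x0] are the images under [psi g] of [x0] and
    [psi (g^-1 * h) x0]. So [rp] bounds their distance in terms of [g^-1 * h], while [rm] and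
    properness confine [g^-1 * h] when they are close. *)
Lemma orbit_coarse_equivalence (R : realType) (G : groupType)
    (X : metricType R) (psi : G -> X -> X) :
  coarse_near_action psi -> proper_near_action psi ->
  cobounded_near_action psi ->
  exists x0, coarse_equivalence (@group_controlled G)
    (dist_controlled (@mdist R X)) (psi^~ x0).
Proof.
move=> [C [rm [rp [C0 [_ rm_nd rp_nd rm_infty] _ psiM psi_emb]]]] psi_proper.
move=> [x0 [r0 [_ psi_cob]]]; exists x0.
have psiD g h : mdist (psi h x0) (psi g (psi (g^-1 * h)%g x0)) <= C.
  by have := psiM g (g^-1 * h)%g x0; rewrite mulVKg.
split.
- move=> D [F finF FP].
  have [r rP] : has_ubound [set rp (mdist x0 (psi k x0)) | k in F].
    by apply: finite_set_has_ubound; exact: finite_image.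
  exists (r + C) => _ _ [[g h] /FP gh [<- <-]] /=.
  apply: le_trans (metric_triangle _ (psi g (psi (g^-1 * h)%g x0)) _) _.
  rewrite lerD//; last by rewrite metric_sym.
  have /andP[_ /le_trans->]// := psi_emb g x0 (psi (g^-1 * h)%g x0).
  by apply: rP; exists (g^-1 * h)%g.
- move=> D [r rP].
  have [s s0 sP] : exists2 s, 0 < s & forall t, s <= t -> r + C < rm t.
    have [s s0 sP] := pinfty_ex_gt0 (cvgry_gt rm_infty (r + C)).
    exists s => // t st; apply: lt_le_trans sP _.
    by apply: rm_nd => //; rewrite nnegrE ltW// (lt_le_trans s0).
  have [M MP] := psi_proper s s0.
  exists [set k | (psi k @` cball x0 s) `&` cball x0 s !=set0].
    by apply/finite_set_leP; exists M; exact: MP.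
  move=> g h /rP /= gh; exists (psi (g^-1 * h)%g x0); split.
    by exists x0 => //; rewrite /cball/= mdistxx ltW.
  rewrite /cball/= leNgt; apply/negP => /ltW/sP; apply/negP; rewrite -leNgt.
  have /andP[/le_trans-> //] := psi_emb g x0 (psi (g^-1 * h)%g x0).
  by rewrite (le_trans (metric_triangle _ (psi h x0) _))// lerD.
- exists [set p | mdist p.1 p.2 <= r0]; first by exists r0.
  by move=> y; have [g /ltW gy] := psi_cob y; exists g.
Qed.

(** The optimal control functions serve: [rho_p] is a supremum of image distances, and [rho_m] is
    the best lower bound, capped. *)
Lemma exists_control_pair (R : realType) (I : Type) (X Y : metricType R)
    (f : I -> X -> Y) :
  (forall r, exists s, forall i x y, mdist x y <= r -> mdist (f i x) (f i y) <= s) ->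
  (forall s, exists r, forall i x y, mdist (f i x) (f i y) <= s -> mdist x y <= r) ->
  exists rho_m rho_p : R -> R, control_pair rho_m rho_p /\
    forall i, coarse_embedding rho_m rho_p (f i).
Proof.
move=> fU fL.
(* Capping at [r] keeps the supremum finite when no two points are at distance
   at least [r]. *)
pose Am (r : R) := [set s | 0 <= s <= r /\
  forall i x y, r <= mdist x y -> s <= mdist (f i x) (f i y)].
pose Ap (r : R) := [set s | exists i x y,
  mdist x y <= r /\ s = mdist (f i x) (f i y)].
have Am0 r : 0 <= r -> Am r 0 by move=> r0; split=> [|*]; rewrite ?lexx ?mdist_ge0.
have Am_ub r : has_ubound (Am r) by exists r => s [/andP[]].
have Ap_ub r : has_ubound (Ap r).
  by have [s sP] := fU r; exists s => _ [i [x [y [/sP xy ->]]]].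
have Ap_ge0 r : 0 <= sup (Ap r).
  (* [Ap r] can be empty, for instance when [r < 0]; its supremum is then 0 by default. *)
  have [->|/set0P[s Aps]] := eqVneq (Ap r) set0; first by rewrite sup0.
  apply: (le_trans _ (ub_le_sup (Ap_ub r) Aps)).
  by case: Aps => i [x [y [_ ->]]]; exact: mdist_ge0.
exists (fun r => sup (Am r)), (fun r => sup (Ap r)); split.
- split.
  + by move=> r r0; split=> //; apply: ub_le_sup => //; exact: Am0.
  + move=> r s; rewrite !nnegrE => r0 s0 rs; apply: ge_sup; first by exists 0; exact: Am0.
    move=> t [/andP[t0 tr] tP]; apply: ub_le_sup => //; split.
      by rewrite t0 (le_trans tr).
    by move=> i x y /(le_trans rs)/tP.
  + move=> r s _ _ rs; have [->|/set0P Ap0] := eqVneq (Ap r) set0.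
      by rewrite sup0.
    apply: ge_sup => // _ [i [x [y [xy ->]]]]; apply: ub_le_sup => //.
    by exists i, x, y; rewrite (le_trans xy).
  (* For [t > r], points at distance at least [t] have images more than [s] apart; the cap also
     requires [s <= t]. Then [s] lies in [Am t] if it is nonnegative, and 0 serves otherwise. *)
  + apply/cvgryPge => s; have [r rP] := fL s.
    near=> t.
    have t0 : 0 <= t by near: t; apply: nbhs_pinfty_ge; exact: num_real.
    have st : s <= t by near: t; apply: nbhs_pinfty_ge; exact: num_real.
    have rt : r < t by near: t; apply: nbhs_pinfty_gt; exact: num_real.
    have [s0|/ltW s0] := lerP s 0.
      by rewrite (le_trans s0)//; apply: ub_le_sup => //; exact: Am0.
    apply: ub_le_sup => //; split; first by rewrite s0.
    move=> i x y txy; rewrite leNgt; apply/negP => /ltW/rP.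
    by apply/negP; rewrite -ltNge; apply: lt_le_trans txy.
- move=> i x y; apply/andP; split.
    by apply: ge_sup; [exists 0; exact/Am0/mdist_ge0|move=> s [_ sP]; exact: sP].
  by apply: ub_le_sup => //; exists i, x, y.
Unshelve. all: by end_near.
Qed.

(** Left translation preserves [g^-1 * h], so the bounds on [psi g] are uniform in [g]. The product
    law holds up to a constant because [p (q k)] stays within a finite set of [k]. *)
Lemma coarse_equivalence_near_action (R : realType) (G : groupType)
    (X : metricType R) (q : G -> X) (x0 : X) :
  coarse_equivalence (@group_controlled G) (dist_controlled (@mdist R X)) q ->
  exists psi : G -> X -> X, [/\ coarse_near_action psi,
    proper_near_action psi & cobounded_near_action psi].
Proof.
move=> [qU qL [D0 [c cP] /choice[p /(_ _)/cP pP]]].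
have qU' F : finite_set F ->
    exists r, forall g h, F (g^-1 * h)%g -> mdist (q g) (q h) <= r.
  move=> finF; have [|r rP] := qU [set u | F (u.1^-1 * u.2)%g]; first by exists F.
  by exists r => g h gh; apply: rP; exists (g, h).
have qL' r : exists2 F, finite_set F &
    forall g h, mdist (q g) (q h) <= r -> F (g^-1 * h)%g.
  have [|F finF FP] := qL [set u | mdist u.1 u.2 <= r]; first by exists r.
  by exists F => // g h gh; exact: FP.
have pL r : exists2 F, finite_set F &
    forall x y, mdist x y <= r -> F ((p x)^-1 * p y)%g.
  have [F finF FP] := qL' (c + r + c); exists F => // x y xy; apply: FP.
  rewrite (le_trans (metric_triangle _ y _))// lerD//; last by rewrite metric_sym.
  by rewrite (le_trans (metric_triangle _ x _))// lerD.
have pU F : finite_set F -> exists r, forall x y,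
    F ((p x)^-1 * p y)%g -> mdist x y <= r.
  move=> /qU'[r rP]; exists (c + r + c) => x y /rP xy.
  rewrite (le_trans (metric_triangle _ (q (p y)) _))// lerD//.
  rewrite (le_trans (metric_triangle _ (q (p x)) _))// lerD//.
  by rewrite metric_sym.
have trl (g h k : G) : ((g * h)^-1 * (g * k) = h^-1 * k)%g.
  by rewrite invgM mulgA mulgVK.
pose psi (g : G) x := q (g * p x)%g.
have psiU r : exists s, forall g x y,
    mdist x y <= r -> mdist (psi g x) (psi g y) <= s.
  have [F /qU'[s sP] FP] := pL r; exists s => g x y /FP xy.
  by apply: sP; rewrite trl.
have psiL s : exists r, forall g x y,
    mdist (psi g x) (psi g y) <= s -> mdist x y <= r.
  have [F /pU[r rP] FP] := qL' s; exists r => g x y /FP xy.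
  by apply: rP; rewrite trl in xy.
exists psi; split.
- have [rm [rp [rmp psi_emb]]] := exists_control_pair psiU psiL.
  have [F /qU'[s sP] FP] := qL' c.
  exists (Num.max c s), rm, rp; split => //.
  + by rewrite le_max (le_trans (mdist_ge0 _ _) (pP x0)).
  + by move=> x; rewrite /psi mul1g le_max pP.
  + move=> g h x; rewrite le_max /psi; apply/orP; right; apply: sP.
    by rewrite -mulgA trl; apply: FP; rewrite metric_sym.
- move=> r r0; have [s sP] := psiU r; have [F finF FP] := qL' (s + r + c).
  have [M FM] := (finite_set_leP F).1 finF; exists M => x y.
  apply: card_le_trans FM.
  (* Each such [g] is recovered from [(p y)^-1 * g * p x], which lies in [F]; since [F] depends only
     on [r], so does [M]. *)
  apply: card_le_trans (card_image_le (fun k => p y * k * (p x)^-1)%g F).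
  apply: subset_card_le => g [_ [[u xu <-]] yu].
  exists ((p y)^-1 * (g * p x))%g; last by rewrite mulVKg mulgK.
  apply: FP; rewrite metric_sym.
  rewrite (le_trans (metric_triangle _ y _))// lerD//; last by rewrite metric_sym.
  rewrite (le_trans (metric_triangle _ (psi g u) _))// lerD//; first exact: sP.
  by rewrite metric_sym.
(* The extra 1 makes both the radius positive and the bound strict. *)
- exists x0, (c + 1); split.
    by rewrite ltr_wpDl// (le_trans (mdist_ge0 _ _) (pP x0)).
  move=> y; exists (p y * (p x0)^-1)%g.
  by rewrite /psi mulgVK (le_lt_trans (pP y))// ltrDl.
Qed.

(** * Transfer of boundaries *)

Lemma cZ_boundary_coarse_invariant (R : realType) (G H : groupType)
    (f : H -> G) (Z : topologicalType) :
  coarse_equivalence (@group_controlled H) (@group_controlled G) f ->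
  cZ_boundary R G Z -> cZ_boundary R H Z.
Proof.
move=> f_ce [X [Xbar [i [j [psi [XZ psi_act psi_proper psi_cob]]]]]].
have [x0 orb_ce] := orbit_coarse_equivalence psi_act psi_proper psi_cob.
have := coarse_equivalence_comp (mdist_controlled_coarse X) f_ce orb_ce.
move=> /(coarse_equivalence_near_action x0)[psiH [? ? ?]].
by exists X, Xbar, i, j, psiH.
Qed.

Theorem theorem0p1 (R : realType) (G H : groupType)
  (hG : exists Z : topologicalType, cZ_boundary R G Z)
  (hGH : quasi_isometric R G H) :
  (exists Z : topologicalType, cZ_boundary R H Z) /\
  (forall Z : topologicalType, cZ_boundary R G Z <-> cZ_boundary R H Z).
Proof.
have [S [T [finS genS finT genT [f /quasi_isometry_coarse]]]] := hGH.
rewrite !word_dist_controlled// => f_ce.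
(* Boundaries are pulled back along maps: [f] carries those of [H] to [G], and [f'] those of [G] to
   [H]. *)
have [f' f'_ce] := coarse_equivalence_inverse (group_controlled_coarse G)
  (group_controlled_coarse H) f_ce.
split; last by move=> Z; split; [exact: cZ_boundary_coarse_invariant f'_ce|
                                exact: cZ_boundary_coarse_invariant f_ce].
by have [Z GZ] := hG; exists Z; exact: cZ_boundary_coarse_invariant f'_ce GZ.
Qed.
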